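(* Fix a dimension $d\ge2$. There is a constant $C_d$ depending only on $d$ such that the following holds. Let $n,n_0,p$ be positive integers with $p\le n_0\le 2p$, and put $N_0=n_0^d$ and $N=n^d$. Let $I=[n]^d$ be the index set of the uniform tensor grid on $[0,1]^d$ with $n$ points in each direction, let $T_I$ be the tensor node cluster tree constructed by recursive $2^d$ uniform partition, each of whose leaf nodes contains at most $N_0$ points, and let $T_{I\times I}$ be the corresponding tensor node block cluster tree under the strong admissibility condition with $\eta=\sqrt d$. If $\boldsymbol{A}^{\mathrm{HTLR}}$ is an HTLR matrix on $T_{I\times I}$ of rank $p$, then the storage required for $\boldsymbol{A}^{\mathrm{HTLR}}$ is at most $C_d\,p^dN$, i.e. it is $O(p^dN)$ with prefactor depending only on $d$.
   Context: Notation: $[n]=\{1,\dots,n\}$, $h=1/n$. Grid: the grid point with multi-index $\boldsymbol{i}=(i_1,\dots,i_d)\in[n]^d$ is $\boldsymbol{x}_{\boldsymbol{i}}=((i_1-\tfrac12)h,\dots,(i_d-\tfrac12)h)$, with computational domain $\Omega_{\boldsymbol{i}}=\prod_\ell[(i_\ell-1)h,i_\ell h]$. For $\tau\subset I$, $\Omega_\tau=\bigcup_{\boldsymbol{i}\in\tau}\Omega_{\boldsymbol{i}}$. Cluster tree: a tree $T_I$ whose nodes are nonempty subsets of $I$, with root $I$, such that each node either has no children (a leaf) or is the disjoint union of its children. It is a tensor node cluster tree if every node has the form $\tau=\tau_1\times\dots\times\tau_d$, with $\tau_\ell$ an index set for the $\ell$-th dimension. Recursive $2^d$ uniform partition: a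 node $\tau$ with $|\tau|\le N_0$ is a leaf and is not partitioned further; a node with $|\tau|>N_0$ is split into (up to) $2^d$ children by splitting each index interval $\tau_\ell$ into two consecutive intervals of sizes as equal as possible (empty children are discarded). Strong admissibility with parameter $\eta>0$: two nodes $\tau,\sigma$ are admissible if $\max\{\operatorname{diam}(\Omega_\tau),\operatorname{diam}(\Omega_\sigma)\}\le\eta\operatorname{dist}(\Omega_\tau,\Omega_\sigma)$, where $\operatorname{diam}(\Omega_\tau)=\max_{\boldsymbol{x},\boldsymbol{y}\in\Omega_\tau}\|\boldsymbol{x}-\boldsymbol{y}\|$ and $\operatorname{dist}(\Omega_\tau,\Omega_\sigma)=\min_{\boldsymbol{x}\in\Omega_\tau,\boldsymbol{y}\in\Omega_\sigma}\|\boldsymbol{x}-\boldsymbol{y}\|$ (Euclidean norm). Block cluster tree $T_{I\times I}$: built from the root $(I,I)$ as follows. If $\tau,\sigma$ are admissible, $(\tau,\sigma)$ is an admissible leaf; otherwise, if $\tau$ or $\sigma$ is a leaf of $T_I$, $(\tau,\sigma)$ is an inadmissible leaf; otherwise $(\tau,\sigma)$ is a non-leaf node with children all $(\tau',\sigma')\in\operatorname{children}(\tau)\times\operatorname{children}(\sigma)$. It is called a tensor node block cluster tree when $T_I$ is a tensor node cluster tree. HTLR (hierarchical Tucker low-rank) matrix of rank $p$ on $T_{I\times I}$: a matrix $\boldsymbol{A}^{\mathrm{HTLR}}\in\mathbb{R}^{I\times I}$ stored as follows. For an admissible leaf $(\tau,\sigma)$, the block $\boldsymbol{A}^{\mathrm{HTLR}}_{\tau,\sigma}$,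 viewed as a $2d$-order tensor, is given in Tucker form $\boldsymbol{\mathcal{G}}\times_1\boldsymbol{U}_1\times_2\cdots\times_d\boldsymbol{U}_d\times_{d+1}\boldsymbol{V}_1\times_{d+2}\cdots\times_{2d}\boldsymbol{V}_d$ with $\boldsymbol{U}_\ell\in\mathbb{R}^{|\tau_\ell|\times p}$, $\boldsymbol{V}_\ell\in\mathbb{R}^{|\sigma_\ell|\times p}$, $\boldsymbol{\mathcal{G}}\in\mathbb{R}^{p\times\dots\times p}$ ($2d$ modes), where $\times_\ell$ is the mode-$\ell$ product. For an inadmissible leaf, the block is a dense matrix. For a non-leaf node, the block is the block matrix made of the blocks of its children. Storage: the total number of real numbers stored, namely $\sum_\ell(|\tau_\ell|+|\sigma_\ell|)p+p^{2d}$ for each admissible leaf and $|\tau||\sigma|$ for each inadmissible leaf. *)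

(* Defs.v *)
From mathcomp Require Import all_boot all_order all_algebra.
From mathcomp Require Import all_classical all_reals.

Set Implicit Arguments.
Unset Strict Implicit.
Unset Printing Implicit Defensive.

Import Order.TTheory GRing.Theory Num.Theory.
Local Open Scope classical_set_scope.
Local Open Scope ring_scope.

(* Indices are zero-based: i : multi_index d n stands for the multi-index
   (i_1 + 1, ..., i_d + 1) of [n]^d. *)
Definition multi_index (d n : nat) := {ffun 'I_d -> 'I_n}.

Definition enorm (R : realType) (d : nat) (x : 'rV[R]_d) : R :=
  Num.sqrt (\sum_(l < d) x 0 l ^+ 2).

(* For the nonempty compact sets used below, sup and inf are a max and a min. *)
Definition diam (R : realType) (d : nat) (X : set 'rV[R]_d) : R :=
  sup [set r : R | exists x y, [/\ X x, X y & r = enorm (x - y)]].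

Definition dist (R : realType) (d : nat) (X Y : set 'rV[R]_d) : R :=
  inf [set r : R | exists x y, [/\ X x, Y y & r = enorm (x - y)]].

Definition cell (R : realType) (d n : nat) (i : multi_index d n) :
    set 'rV[R]_d :=
  [set x | forall l : 'I_d, (i l)%:R / n%:R <= x 0 l <= (i l).+1%:R / n%:R].
Arguments cell R {d n} i _.

Definition cluster_domain (R : realType) (d n : nat)
    (tau : {set multi_index d n}) : set 'rV[R]_d :=
  \bigcup_(i in [set` tau]) cell R i.
Arguments cluster_domain R {d n} tau _.

Definition admissible (R : realType) (d n : nat) (eta : R)
    (tau sigma : {set multi_index d n}) : bool :=
  Num.max (diam (cluster_domain R tau)) (diam (cluster_domain R sigma))
    <= eta * dist (cluster_domain R tau) (cluster_domain R sigma).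

Inductive cluster_tree (I : finType) : Type :=
  Cluster of {set I} & seq (cluster_tree I).

Definition label (I : finType) (t : cluster_tree I) : {set I} :=
  let: Cluster tau _ := t in tau.

(* P receives the label of a node and the list of labels of its children. *)
Fixpoint every_node (I : finType) (P : {set I} -> seq {set I} -> Prop)
    (t : cluster_tree I) : Prop :=
  let: Cluster tau ch := t in
  P tau [seq label c | c <- ch] /\
  foldr (fun c Q => every_node P c /\ Q) True ch.

Definition is_cluster_tree (I : finType) (t : cluster_tree I) : Prop :=
  label t = finset.setT /\
  every_node (fun tau ch => tau != finset.set0 /\
    (ch = [::] \/ uniq ch /\ finset.partition [set:: ch]%SET tau)) t.

Definition tensor_set (d n : nat) (tau_ : 'I_d -> {set 'I_n}) :
    {set multi_index d n} :=
  [set i : multi_index d n | [forall l, i l \in tau_ l]]%SET.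

Definition is_tensor_node_tree (d n : nat) (t : cluster_tree (multi_index d n)) :
    Prop :=
  every_node
    (fun tau _ => exists tau_ : 'I_d -> {set 'I_n}, tau = tensor_set tau_) t.

Definition ord_interval (n a b : nat) : {set 'I_n} :=
  [set i : 'I_n | a <= i < b]%SET%N.

(* When #|A| is odd, either half may be the larger one. *)
Definition halving (n : nat) (A A0 A1 : {set 'I_n}) : Prop :=
  exists a m b : nat,
    [/\ (a <= m <= b)%N,
        A = ord_interval n a b,
        A0 = ord_interval n a m,
        A1 = ord_interval n m b
      & (#|A0| <= #|A1|.+1)%N /\ (#|A1| <= #|A0|.+1)%N].

Definition uniform_split (d n : nat) (tau : {set multi_index d n})
    (ch : seq {set multi_index d n}) : Prop :=
  exists (tau_ : 'I_d -> {set 'I_n}) (half : 'I_d -> bool -> {set 'I_n}),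
    [/\ tau = tensor_set tau_,
        forall l, halving (tau_ l) (half l false) (half l true)
      & perm_eq ch
          [seq c <- [seq tensor_set (fun l => half l (b l))
                       | b : {ffun 'I_d -> bool}]
             | c != finset.set0]].

Definition recursive_uniform_partition (d n N0 : nat)
    (t : cluster_tree (multi_index d n)) : Prop :=
  every_node (fun tau ch =>
    if (#|tau| <= N0)%N then ch = [::] else uniform_split tau ch) t.

Inductive block_tree (I : finType) : Type :=
| AdmissibleLeaf of {set I} & {set I}
| InadmissibleLeaf of {set I} & {set I}
| BlockNode of {set I} & {set I} & seq (block_tree I).

Fixpoint block_cluster_tree (R : realType) (d n : nat) (eta : R)
    (t s : cluster_tree (multi_index d n)) : block_tree (multi_index d n) :=
  let: Cluster tau tch := t in
  let: Cluster sigma sch := s in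
  if admissible eta tau sigma then AdmissibleLeaf tau sigma
  else if nilp tch || nilp sch then InadmissibleLeaf tau sigma
  else BlockNode tau sigma
         [seq block_cluster_tree eta t' s' | t' <- tch, s' <- sch].

(* The side tau_l of a nonempty tensor node tau = tau_1 x ... x tau_d. *)
Definition side (d n : nat) (tau : {set multi_index d n}) (l : 'I_d) :
    {set 'I_n} :=
  [set i l | i : multi_index d n in tau]%SET.

Record tucker (R : realType) (d n p : nat) (tau sigma : {set multi_index d n}) :=
  Tucker {
    core : {ffun {ffun 'I_(d + d) -> 'I_p} -> R};
    rowf : forall l : 'I_d, 'M[R]_(#|side tau l|, p);
    colf : forall l : 'I_d, 'M[R]_(#|side sigma l|, p)
  }.

(* The entry at (r, s) of core x_1 U_1 ... x_d U_d x_{d+1} V_1 ... x_{2d} V_d,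
   with the mode products written out. *)
Definition tucker_entry (R : realType) (d n p : nat)
    (tau sigma : {set multi_index d n}) (X : tucker R p tau sigma)
    (r : forall l : 'I_d, 'I_#|side tau l|)
    (s : forall l : 'I_d, 'I_#|side sigma l|) : R :=
  \sum_(k : {ffun 'I_(d + d) -> 'I_p})
    core X k * (\prod_(l < d) rowf X l (r l) (k (lshift d l)))
             * (\prod_(l < d) colf X l (s l) (k (rshift d l))).

Inductive htlr (R : realType) (d n p : nat) :
    block_tree (multi_index d n) -> Type :=
| HTucker (tau sigma : {set multi_index d n}) of tucker R p tau sigma :
    htlr R p (AdmissibleLeaf tau sigma)
| HDense (tau sigma : {set multi_index d n}) of 'M[R]_(#|tau|, #|sigma|) :
    htlr R p (InadmissibleLeaf tau sigma)
| HBlock (tau sigma : {set multi_index d n})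
    (ch : seq (block_tree (multi_index d n)))
    of (forall k : 'I_(size ch), htlr R p (tnth (in_tuple ch) k)) :
    htlr R p (BlockNode tau sigma ch).

(* H stores the block of A at the root of its block tree; the rows and columns
   of stored arrays are numbered by enum_val. *)
Fixpoint stores (R : realType) (d n p : nat) (b : block_tree (multi_index d n))
    (H : htlr R p b) (A : multi_index d n -> multi_index d n -> R) : Prop :=
  match H with
  | HTucker tau sigma X =>
      forall (r : forall l : 'I_d, 'I_#|side tau l|)
             (s : forall l : 'I_d, 'I_#|side sigma l|),
        A [ffun l => enum_val (r l)] [ffun l => enum_val (s l)]
          = tucker_entry X r s
  | HDense tau sigma M =>
      forall (r : 'I_#|tau|) (s : 'I_#|sigma|),
        A (enum_val r) (enum_val s) = M r s
  | HBlock tau sigma ch f => forall k, stores (f k) A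
  end.

Fixpoint storage (R : realType) (d n p : nat) (b : block_tree (multi_index d n))
    (H : htlr R p b) : nat :=
  match H with
  | HTucker tau sigma _ =>
      \sum_(l < d) (#|side tau l| + #|side sigma l|) * p + p ^ (2 * d)
  | HDense tau sigma _ => #|tau| * #|sigma|
  | HBlock tau sigma ch f => \sum_(k < size ch) storage (f k)
  end%N.

(* Main.v *)
Require Import Defs.
From HB Require Import structures.
From mathcomp Require Import all_boot all_order all_algebra.
From mathcomp Require Import all_classical all_reals.
From mathcomp Require Import zify lra.
(** Write [m = n %/ 2 ^ k]. Recursive halving keeps the nodes of level [k] nearly
    cubic: each is a box whose sides all have [m] or [m + 1] points
    ([regular_child]). The block tree descends both cluster trees in step, so it
    only pairs nodes of equal level, and the proof counts these pairs.

    How many pairs are subdivided? With [eta = sqrt d] two boxes of level [k] are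
    admissible as soon as their gap in one direction reaches the maximal side,
    because the diameter is at most [sqrt d] times that side and the distance at
    least that gap ([admissible_far_boxes]). So the partners of a given
    node that prevent admissibility lie in a box around it of side at most
    [5 (m + 1) <= 10 m]; being disjoint and of volume at least [m ^ d], there are
    at most [10 ^ d] of them ([expanding_partners_le]). As level [k] has at most
    [2 ^ (d k)] nodes, at most [2 ^ (d k) 10 ^ d] pairs are subdivided there,
    each into at most [4 ^ d] pairs.

    What does a leaf pair cost? Let [K] be the least depth with [n < n0 2 ^ K]; all
    subdivision stops before level [K]. At level [k] the sides are at most
    [n0 2 ^ (K - k)], and [n0 <= 2 p], so the Tucker factors need
    [O(p ^ 2 2 ^ (K - k))] numbers and the core [p ^ (2 d)]. A dense block contains
    a cluster with at most [n0 ^ d] points, whence both its clusters have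
    [O(p ^ d)] points. Either way the cost is [O(p ^ (2 d) 2 ^ (K - k))]
    ([leaf_storage_le]).

    Since [d >= 2], the sum over [k] of [2 ^ (d k) 2 ^ (K - k)] is of the order of
    its last term [2 ^ (d K)], and [2 ^ K <= 2 n / n0 <= 2 n / p] turns
    [p ^ (2 d) 2 ^ (d K)] into [2 ^ d p ^ d n ^ d]. The remaining case [n < n0],
    where [2 ^ K] is not controlled by [n / n0], is a single dense block: the
    whole grid is never admissible with itself ([not_admissible_self]). *)

Set Implicit Arguments.
Unset Strict Implicit.
Unset Printing Implicit Defensive.
Import Order.TTheory GRing.Theory Num.Theory.
Local Open Scope ring_scope.

(** * Boxes of grid points *)

Definition box (d n : nat) (a b : 'I_d -> nat) : {set multi_index d n} :=
  tensor_set (fun l => ord_interval n (a l) (b l)).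

Lemma mem_tensor_set (d n : nat) (A : 'I_d -> {set 'I_n})
    (i : multi_index d n) :
  (i \in tensor_set A) = [forall l, i l \in A l].
Proof. by rewrite inE. Qed.

Lemma mem_box (d n : nat) (a b : 'I_d -> nat) (i : multi_index d n) :
  (i \in box n a b) = [forall l, (a l <= i l < b l)%N].
Proof. by rewrite mem_tensor_set; apply: eq_forallb => l; rewrite inE. Qed.

Lemma card_ord_interval (n a b : nat) :
  #|ord_interval n a b| = (minn b n - a)%N.
Proof.
rewrite -sum1_card big_mkcond /=.
under eq_bigr => i _ do rewrite inE.
elim: n => [|n IH]; first by rewrite big_ord0; lia.
by rewrite big_ord_recr /= IH; case: ifP; lia.
Qed.

Lemma card_tensor_set (d n : nat) (A : 'I_d -> {set 'I_n}) :
  #|tensor_set A| = (\prod_(l < d) #|A l|)%N.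
Proof.
rewrite -[LHS](_ : #|family (fun l => mem (A l))| = _); last first.
  by apply: eq_card => i; rewrite mem_tensor_set.
by rewrite card_family foldrE big_map big_enum.
Qed.

Lemma side_tensor_set (d n : nat) (A : 'I_d -> {set 'I_n}) (l : 'I_d) :
  side (tensor_set A) l \subset A l.
Proof.
apply/fintype.subsetP => x /imsetP[i]; rewrite mem_tensor_set.
by move/forallP => /(_ l) + ->.
Qed.

(** The empty tensor set has many descriptions; in a nonempty one, changing one
    coordinate of a point shows which values its side allows. *)
Lemma tensor_set_inj (d n : nat) (A B : 'I_d -> {set 'I_n}) :
  tensor_set A = tensor_set B -> tensor_set A != finset.set0 -> A =1 B.
Proof.
have sub A' B' : tensor_set A' = tensor_set B' ->
    tensor_set A' != finset.set0 -> forall l, A' l \subset B' l.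
  move=> eqAB /set0Pn[i]; rewrite mem_tensor_set => /forallP Ai l.
  apply/fintype.subsetP => x A'x.
  have: [ffun l' => if l' == l then x else i l'] \in tensor_set B'.
    rewrite -eqAB mem_tensor_set; apply/forallP => l'; rewrite ffunE.
    by case: eqP => [->|].
  by rewrite mem_tensor_set => /forallP/(_ l); rewrite ffunE eqxx.
move=> eqAB A0 l; apply/eqP.
by rewrite finset.eqEsubset !sub // -?eqAB.
Qed.

(** * Distances and diameters of boxes *)

Section Geometry.
Variables (R : realType) (d n : nat).
Implicit Types (x y : 'rV[R]_d) (r : R).

Lemma enorm_ge0 x : 0 <= enorm x.
Proof. exact: sqrtr_ge0. Qed.

Lemma enorm0 : enorm (0 : 'rV[R]_d) = 0.
Proof.
by rewrite /enorm big1 ?sqrtr0 // => l _; rewrite mxE expr0n.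
Qed.

Lemma coord_le_enorm x l : `|x 0 l| <= enorm x.
Proof.
rewrite -sqrtr_sqr ler_sqrt ?sumr_ge0 // => [|i _]; last exact: sqr_ge0.
by rewrite (bigD1 l) //= lerDl sumr_ge0 // => i _; exact: sqr_ge0.
Qed.

Lemma enorm_le_max x r :
  0 <= r -> (forall l, `|x 0 l| <= r) -> enorm x <= Num.sqrt d%:R * r.
Proof.
move=> r0 xr; rewrite -[r in leRHS]ger0_norm// -sqrtr_sqr -sqrtrM ?ler0n//.
rewrite ler_sqrt ?mulr_ge0 ?ler0n ?sqr_ge0//.
rewrite -[d in leRHS]card_ord mulr_natl -sumr_const ler_sum // => l _.
by rewrite -[x 0 l ^+ 2]real_normK ?num_real// lerXn2r ?nnegrE.
Qed.

Hypothesis n0 : (0 < n)%N.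
Let hn : (n%:R : R) > 0. Proof. by rewrite ltr0n. Qed.

Lemma cluster_domain_box (a b : 'I_d -> nat) x l :
  cluster_domain R (box n a b) x ->
  (a l)%:R / n%:R <= x 0 l <= (b l)%:R / n%:R.
Proof.
move=> [i]; rewrite /= mem_box => /forallP/(_ l)/andP[ai ib] /(_ l)/andP[lx xu].
rewrite (le_trans _ lx) ?(le_trans xu)//;
  by rewrite ler_pM2r ?invr_gt0 // ler_nat.
Qed.

Lemma cluster_domain_neq0 (tau : {set multi_index d n}) :
  tau != finset.set0 -> (cluster_domain R tau !=set0)%classic.
Proof.
move=> /set0Pn[i ti]; exists (\row_l ((i l)%:R / n%:R)); exists i => // l.
by rewrite mxE lexx ler_pM2r ?invr_gt0 // ler_nat /=.
Qed.

Lemma enorm_box_le (a b : 'I_d -> nat) (m : nat) x y :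
  (forall l, b l - a l <= m)%N ->
  cluster_domain R (box n a b) x -> cluster_domain R (box n a b) y ->
  enorm (x - y) <= Num.sqrt d%:R * (m%:R / n%:R).
Proof.
move=> abm Xx Xy; apply: enorm_le_max; first by rewrite divr_ge0.
move=> l; rewrite !mxE.
have /andP[ax xb] := cluster_domain_box l Xx.
have /andP[ay yb] := cluster_domain_box l Xy.
have : (b l)%:R / n%:R <= (a l)%:R / n%:R + m%:R / n%:R :> R.
  by rewrite -mulrDl ler_pM2r ?invr_gt0 // -natrD ler_nat; have := abm l; lia.
by rewrite ler_norml; lra.
Qed.

Lemma diam_box_le (a b : 'I_d -> nat) (m : nat) :
  (forall l, b l - a l <= m)%N -> box n a b != finset.set0 ->
  diam (cluster_domain R (box n a b)) <= Num.sqrt d%:R * (m%:R / n%:R).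
Proof.
move=> abm /cluster_domain_neq0[x Xx]; apply: ge_sup.
  by exists (enorm (x - x)), x, x.
by move=> _ [y [z [Xy Xz ->]]]; exact: enorm_box_le Xy Xz.
Qed.

(** The Euclidean distance dominates the gap in any single direction. *)
Lemma dist_box_ge (a b a' b' : 'I_d -> nat) (m : nat) l :
  (b l + m <= a' l)%N ->
  box n a b != finset.set0 -> box n a' b' != finset.set0 ->
  m%:R / n%:R <= dist (cluster_domain R (box n a b))
                      (cluster_domain R (box n a' b')) /\
  m%:R / n%:R <= dist (cluster_domain R (box n a' b'))
                      (cluster_domain R (box n a b)).
Proof.
move=> bma /cluster_domain_neq0[x Xx] /cluster_domain_neq0[y Yy].
have gap z t : cluster_domain R (box n a b) z ->
    cluster_domain R (box n a' b') t -> m%:R / n%:R <= t 0 l - z 0 l.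
  move=> /(cluster_domain_box l)/andP[_ zb] /(cluster_domain_box l)/andP[ta _].
  have : (b l)%:R / n%:R + m%:R / n%:R <= (a' l)%:R / n%:R :> R.
    by rewrite -mulrDl ler_pM2r ?invr_gt0 // -natrD ler_nat.
  lra.
split; apply: lb_le_inf.
- by exists (enorm (x - y)), x, y.
- move=> _ [z [t [Xz Yt ->]]]; apply: le_trans (coord_le_enorm _ l).
  by rewrite !mxE distrC; apply: le_trans (gap _ _ Xz Yt) (ler_norm _).
- by exists (enorm (y - x)), y, x.
- move=> _ [t [z [Yt Xz ->]]]; apply: le_trans (coord_le_enorm _ l).
  by rewrite !mxE; apply: le_trans (gap _ _ Xz Yt) (ler_norm _).
Qed.

(** Boxes whose gap in some direction reaches the largest side length are
    admissible: [eta = sqrt d] is exactly the ratio of the diagonal of a cube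
    to its side. *)
Lemma admissible_far_boxes (a b a' b' : 'I_d -> nat) (m : nat) l :
  (forall l, b l - a l <= m)%N -> (forall l, b' l - a' l <= m)%N ->
  box n a b != finset.set0 -> box n a' b' != finset.set0 ->
  (b l + m <= a' l)%N || (b' l + m <= a l)%N ->
  admissible (Num.sqrt d%:R : R) (box n a b) (box n a' b').
Proof.
move=> abm abm' X0 Y0 gap.
have dge : m%:R / n%:R <= dist (cluster_domain R (box n a b))
                               (cluster_domain R (box n a' b')).
  by case/orP: gap => gap; [case: (dist_box_ge gap X0 Y0)
                           | case: (dist_box_ge gap Y0 X0)].
rewrite /admissible ge_max.
apply/andP; split.
  by apply: le_trans (diam_box_le abm X0) _; rewrite ler_wpM2l ?sqrtr_ge0.
by apply: le_trans (diam_box_le abm' Y0) _; rewrite ler_wpM2l ?sqrtr_ge0.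
Qed.

(** The distance of the unit cube to itself is zero and its diameter is not. *)
Lemma not_admissible_self (eta : R) : (0 < d)%N ->
  ~~ admissible eta [set: multi_index d n]%SET [set: multi_index d n]%SET.
Proof.
move=> d0; set tau := [set: _]%SET.
pose X := cluster_domain R tau; pose l0 := Ordinal d0.
have Xx (e : R) : 0 <= e <= 1 / n%:R -> X (const_mx e).
  move=> he; exists [ffun=> Ordinal n0] => [|l]; first by rewrite /= inE.
  by rewrite mxE ffunE /= mul0r.
have dist0 : dist X X = 0.
  apply/eqP; rewrite eq_le; apply/andP; split.
    apply: ge_inf; first by exists 0 => _ [x [y [_ _ ->]]]; exact: enorm_ge0.
    exists (const_mx 0), (const_mx 0); rewrite subrr enorm0; split=> //;
      by apply: Xx; rewrite lexx divr_ge0.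
  apply: lb_le_inf; last by move=> _ [x [y [_ _ ->]]]; exact: enorm_ge0.
  exists (enorm (const_mx 0 - const_mx 0 : 'rV[R]_d)).
  by exists (const_mx 0), (const_mx 0); split=> //; apply: Xx;
    rewrite lexx divr_ge0.
have tauE : tau = box n (fun=> 0%N) (fun=> n).
  by apply/setP => i; rewrite mem_box inE; apply/esym/forallP => l /=.
have diam_gt0 : 0 < diam X.
  apply: (@lt_le_trans _ _ (enorm (const_mx (1 / n%:R) - const_mx 0 : 'rV[R]_d))).
    apply: lt_le_trans (coord_le_enorm _ l0).
    by rewrite !mxE subr0 normr_gt0 mulf_neq0 ?oner_eq0 // invr_eq0 gt_eqF.
  apply: ub_le_sup.
    exists (Num.sqrt d%:R * (n%:R / n%:R)) => _ [x [y [Hx Hy ->]]].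
    rewrite /X tauE in Hx Hy; apply: enorm_box_le Hx Hy => l; lia.
  exists (const_mx (1 / n%:R)), (const_mx 0); split=> //; apply: Xx;
    by rewrite ?lexx ?divr_ge0.
by rewrite /admissible -/X dist0 mulr0 -ltNge lt_max diam_gt0.
Qed.

End Geometry.

(** * Cluster trees and their levels *)

(* Classical equality of trees, to speak of membership in lists of subtrees. *)
HB.instance Definition _ (I : finType) := gen_eqMixin (cluster_tree I).

Section Levels.
Variable I : finType.
Implicit Types (t c : cluster_tree I) (P : {set I} -> seq {set I} -> Prop).

Definition children t : seq (cluster_tree I) := let: Cluster _ ch := t in ch.

Fixpoint level (k : nat) t : seq (cluster_tree I) :=
  if k is k'.+1 then flatten [seq level k' c | c <- children t] else [:: t].

Lemma big_levelS (F : cluster_tree I -> nat) k t :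
  (\sum_(s <- level k.+1 t) F s =
     \sum_(c <- children t) \sum_(s <- level k c) F s)%N.
Proof. by rewrite /= big_flatten big_map. Qed.

Lemma every_node_label P t :
  every_node P t -> P (label t) [seq label c | c <- children t].
Proof. by case: t => tau ch []. Qed.

Lemma every_node_children P t c :
  every_node P t -> c \in children t -> every_node P c.
Proof.
case: t => tau ch [_] /=; elim: ch => //= c' ch IH [Pc' Pch].
by rewrite inE => /predU1P[->|/(IH Pch)].
Qed.

Definition partitioned (tau : {set I}) (ch : seq {set I}) : Prop :=
  tau != finset.set0 /\
    (ch = [::] \/ uniq ch /\ finset.partition [set:: ch]%SET tau).

(** The nodes of one level are pairwise disjoint, so a weight put on the
    indices is counted at most once per level. *)
Lemma level_weight_le (f : I -> nat) k t : every_node partitioned t ->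
  (\sum_(s <- level k t) \sum_(x in label s) f x <= \sum_(x in label t) f x)%N.
Proof.
elim: k t => [|k IH] t Pt; first by rewrite big_seq1.
rewrite big_levelS.
apply: (@leq_trans (\sum_(c <- children t) \sum_(x in label c) f x)%N).
  by rewrite big_seq [leqRHS]big_seq; apply: leq_sum => c /(every_node_children Pt)/IH.
have [_ [/nilP|[Uch Pch]]] := every_node_label Pt.
  by rewrite /nilp size_map => /nilP->; rewrite big_nil.
rewrite (set_partition_big _ Pch).
have -> : (\sum_(c <- children t) \sum_(x in label c) f x =
           \sum_(A <- [seq label c | c <- children t]) \sum_(x in A) f x)%N.
  by rewrite big_map.
by rewrite big_uniq //= eq_leq //; apply: eq_bigl => A; rewrite inE.
Qed.

End Levels.

(** * Recursive uniform partition keeps all sides of a level equal up to one *)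

Definition balanced_box (d n m : nat) (tau : {set multi_index d n}) : Prop :=
  exists a b : 'I_d -> nat,
    tau = box n a b /\ forall l, (a l + m <= b l <= (a l + m).+1)%N /\ (b l <= n)%N.

Lemma balanced_side (d n m : nat) (tau : {set multi_index d n}) (l : 'I_d) :
  balanced_box m tau -> (#|side tau l| <= m.+1)%N.
Proof.
move=> [a [b [-> /(_ l) ab]]]; apply: leq_trans (subset_leq_card (side_tensor_set _ _)) _.
by rewrite card_ord_interval; lia.
Qed.

Lemma card_balanced_box (d n m : nat) (tau : {set multi_index d n}) :
  balanced_box m tau -> (m ^ d <= #|tau| <= m.+1 ^ d)%N.
Proof.
move=> [a [b [-> ab]]]; rewrite card_tensor_set.
rewrite -[X in (m ^ X)%N]card_ord -[X in (m.+1 ^ X)%N]card_ord -!prod_nat_const.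
by apply/andP; split; apply: leq_prod => l _; rewrite card_ord_interval;
  have := ab l; lia.
Qed.

(** A length [m] or [m + 1] has both its halves, rounded either way, among
    [m./2] and [m./2 + 1], so the spread of one point never grows. Intervals
    need not end inside the grid, hence the truncation at [n]. *)
Lemma halving_balanced (n m a b : nat) (A0 A1 : {set 'I_n}) (e : bool) :
  (a + m <= b <= (a + m).+1)%N -> (b <= n)%N ->
  halving (ord_interval n a b) A0 A1 ->
  exists u : nat * nat, (if e then A1 else A0) = ord_interval n u.1 u.2 /\
    (u.1 + m./2 <= u.2 <= (u.1 + m./2).+1)%N /\ (u.2 <= n)%N.
Proof.
move=> abm bn [a' [c [b' [a'cb' AE A0E A1E]]]].
have := congr1 (fun A : {set 'I_n} => #|A|) AE.
rewrite A0E A1E !card_ord_interval => cardE [].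
have clip x y : ord_interval n x y = ord_interval n (minn x n) (minn y n).
  by apply/setP => i; rewrite !inE; have := ltn_ord i; lia.
case: e => bal0 bal1.
  by exists (minn c n, minn b' n); rewrite clip /=; split => //; lia.
by exists (minn a' n, minn c n); rewrite clip /=; split => //; lia.
Qed.

Lemma uniform_split_balanced (d n m : nat) (tau : {set multi_index d n})
    (ch : seq {set multi_index d n}) (c : {set multi_index d n}) :
  tau != finset.set0 -> balanced_box m tau -> uniform_split tau ch ->
  c \in ch -> balanced_box m./2 c.
Proof.
move=> tau0 [a [b [tauE ab]]] [tau_ [half [tauE' halves /perm_mem->]]].
rewrite mem_filter => /andP[_ /fintype.imageP[e _ ->]].
have sidesE : tau_ =1 fun l => ord_interval n (a l) (b l).
  by apply: tensor_set_inj; rewrite -tauE'.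
have {halves} ends l : exists u : nat * nat,
    half l (e l) = ord_interval n u.1 u.2 /\
    (u.1 + m./2 <= u.2 <= (u.1 + m./2).+1)%N /\ (u.2 <= n)%N.
  have [abl bn] := ab l; have := halves l; rewrite sidesE.
  by move=> /(halving_balanced (e l) abl bn); case: (e l).
have [u uP] := fin_all_exists ends.
exists (fun l => (u l).1), (fun l => (u l).2); split; last by move=> l; case: (uP l).
by congr tensor_set; apply/funext => l; case: (uP l).
Qed.

Lemma size_uniform_split (d n : nat) (tau : {set multi_index d n})
    (ch : seq {set multi_index d n}) :
  uniform_split tau ch -> (size ch <= 2 ^ d)%N.
Proof.
move=> [tau_ [half [_ _ /perm_size->]]]; rewrite size_filter.
by apply: leq_trans (count_size _ _) _; rewrite size_image card_ffun card_bool card_ord.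
Qed.

(** A point of the node selects, in every direction, the half it lies in; that
    child is not empty. *)
Lemma uniform_split_neq_nil (d n : nat) (tau : {set multi_index d n}) :
  tau != finset.set0 -> ~ uniform_split tau [::].
Proof.
move=> /set0Pn[i ti] [tau_ [half [tauE halves /perm_mem chE]]].
have sides l : exists e : bool, i l \in half l e.
  have := ti; rewrite tauE mem_tensor_set => /forallP/(_ l).
  have [a [c [b [abc -> h0 h1 _]]]] := halves l; rewrite inE => /andP[ai ib].
  exists (c <= i l)%N.
  by case: (leqP c (i l)) => ic; rewrite ?h0 ?h1 inE ic ?ai ?ib.
have [e eP] := fin_all_exists sides.
have := chE (tensor_set (fun l => half l ([ffun l => e l] l))).
rewrite in_nil mem_filter => /esym/negbT; rewrite negb_and negbK.
case/orP => [/eqP chE0|/negP[]]; last exact: fintype.image_f.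
have : i \in finset.set0.
  by rewrite -chE0 mem_tensor_set; apply/forallP => l; rewrite ffunE.
by rewrite inE.
Qed.

Definition uniform_node (d n N0 : nat) (tau : {set multi_index d n})
    (ch : seq {set multi_index d n}) : Prop :=
  if (#|tau| <= N0)%N then ch = [::] else uniform_split tau ch.

(** The invariant that a node of level [k] passes on to its children. *)
Definition regular (d n N0 k : nat) (t : cluster_tree (multi_index d n)) : Prop :=
  [/\ balanced_box (n %/ 2 ^ k) (label t), every_node (@partitioned _) t
    & every_node (@uniform_node d n N0) t].

Section Regular.
Variables (d n N0 : nat).
Implicit Types (t c : cluster_tree (multi_index d n)) (k : nat).

Lemma regular_label_neq0 k t : regular N0 k t -> label t != finset.set0.
Proof. by move=> [_ /every_node_label[]]. Qed.

Lemma regular_leaf k t :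
  regular N0 k t -> nilp (children t) = (#|label t| <= N0)%N.
Proof.
move=> rt; have tau0 := regular_label_neq0 rt; case: rt => _ _.
move=> /every_node_label; rewrite /uniform_node.
case: ifP => _; first by move=> /nilP; rewrite /nilp size_map => ->.
by case: (children t) => //= /(uniform_split_neq_nil tau0).
Qed.

Lemma regular_child k t c :
  regular N0 k t -> c \in children t -> regular N0 k.+1 c.
Proof.
move=> rt tc; have tau0 := regular_label_neq0 rt.
have leafE := regular_leaf rt; case: rt => bal part unif.
split; [|exact: every_node_children part tc|exact: every_node_children unif tc].
have := every_node_label unif; rewrite /uniform_node -leafE.
case: nilP tc => [-> //|_ tc split_t].
rewrite expnSr divnMA divn2; apply: uniform_split_balanced bal split_t _ => //.
exact: map_f.
Qed.

Lemma regular_size_children k t : regular N0 k t -> (size (children t) <= 2 ^ d)%N.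
Proof.
move=> rt; have leafE := regular_leaf rt; case: rt => _ _ /every_node_label.
rewrite /uniform_node -leafE; case: nilP => [->//|_ /size_uniform_split].
by rewrite size_map.
Qed.

Lemma regular_level k j t s :
  regular N0 k t -> s \in level j t -> regular N0 (k + j) s.
Proof.
elim: j k t => [|j IH] k t rt; first by rewrite inE addn0 => /eqP->.
move=> /flatten_mapP[c tc cs]; rewrite addnS -addSn.
exact: IH (regular_child rt tc) cs.
Qed.

Lemma regular_size_level k j t :
  regular N0 k t -> (size (level j t) <= (2 ^ d) ^ j)%N.
Proof.
elim: j k t => [//|j IH] k t rt.
rewrite -sum1_size big_levelS.
apply: (@leq_trans (\sum_(c <- children t) (2 ^ d) ^ j)%N).
  rewrite big_seq [leqRHS]big_seq; apply: leq_sum => c tc.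
  by rewrite sum1_size; exact: IH (regular_child rt tc).
rewrite big_const_seq count_predT iter_addn_0 mulnC expnS leq_mul2r.
by rewrite (regular_size_children rt) orbT.
Qed.

End Regular.

(** * Storage as a function of the block tree *)

Fixpoint block_storage (d n p : nat) (b : block_tree (multi_index d n)) : nat :=
  match b with
  | AdmissibleLeaf tau sigma =>
      \sum_(l < d) (#|side tau l| + #|side sigma l|) * p + p ^ (2 * d)
  | InadmissibleLeaf tau sigma => #|tau| * #|sigma|
  | BlockNode _ _ ch => sumn [seq block_storage p c | c <- ch]
  end%N.

Lemma storage_block_storage (R : realType) (d n p : nat)
    (b : block_tree (multi_index d n)) (H : htlr R p b) :
  storage H = block_storage p b.
Proof.
elim: H => //= tau sigma ch f IH.
rewrite sumnE big_map [RHS]big_tnth; exact: eq_bigr.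
Qed.

Section Recursion.
Variables (R : realType) (d n p n0 K : nat).
Hypotheses (d_ge2 : (2 <= d)%N) (n_gt0 : (0 < n)%N) (p_gt0 : (0 < p)%N).
Hypotheses (n0_gt0 : (0 < n0)%N) (n0_le : (n0 <= 2 * p)%N).
Hypothesis nK : (n < n0 * 2 ^ K)%N.
Local Notation eta := (Num.sqrt d%:R : R).
Implicit Types (t s : cluster_tree (multi_index d n)) (k j J : nat).

Definition expanding t s : bool :=
  [&& ~~ admissible eta (label t) (label s), ~~ nilp (children t)
    & ~~ nilp (children s)].

Definition expanding_count j t s : nat :=
  (\sum_(t' <- level j t) \sum_(s' <- level j s) expanding t' s')%N.

Lemma expanding_countS j t s :
  (expanding_count j.+1 t s =
   \sum_(t' <- children t) \sum_(s' <- children s) expanding_count j t' s')%N.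
Proof.
rewrite /expanding_count big_levelS; apply: eq_bigr => t' _.
rewrite [RHS]exchange_big; apply: eq_bigr => s' _; exact: big_levelS.
Qed.

Lemma block_storage_expanding t s : expanding t s ->
  (block_storage p (block_cluster_tree eta t s) =
   \sum_(t' <- children t) \sum_(s' <- children s)
     block_storage p (block_cluster_tree eta t' s'))%N.
Proof.
case: t s => [tau tch] [sigma sch] /and3P[/= nadm /negbTE tl /negbTE sl].
by rewrite (negbTE nadm) tl sl /= sumnE big_map big_allpairs_dep.
Qed.

Definition leaf_constant : nat := (4 * d + 1 + 8 ^ d)%N.

(** A leaf pair at level [k] has sides at most [n0 * 2 ^ (K - k)], so its Tucker
    factors cost [O(p ^ 2 * 2 ^ (K - k))]; a dense pair contains a leaf of the
    cluster tree, hence its sides are [O(n0) = O(p)]. *)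
Lemma leaf_storage_le k J t s : (k + J = K)%N ->
  regular (n0 ^ d) k t -> regular (n0 ^ d) k s -> ~~ expanding t s ->
  (block_storage p (block_cluster_tree eta t s)
     <= leaf_constant * p ^ (2 * d) * 2 ^ J)%N.
Proof.
move=> kJ rt rs nexp.
have mlt : (n %/ 2 ^ k < n0 * 2 ^ J)%N.
  by rewrite ltn_divLR ?expn_gt0 // -mulnA -expnD addnC kJ.
have J1 : (0 < 2 ^ J)%N by rewrite expn_gt0.
have leaft := regular_leaf rt; have leafs := regular_leaf rs.
have [balt _ _] := rt; have [bals _ _] := rs.
have sidet l := balanced_side l balt; have sides l := balanced_side l bals.
have dense : nilp (children t) || nilp (children s) ->
    (#|label t| * #|label s| <= leaf_constant * p ^ (2 * d) * 2 ^ J)%N.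
  move=> leaf.
  have /andP[mt Mt] := card_balanced_box balt.
  have /andP[ms Ms] := card_balanced_box bals.
  have mn0 : (n %/ 2 ^ k <= n0)%N.
    rewrite -(@leq_exp2r _ _ d) ?(ltnW d_ge2) //.
    by case/orP: leaf; rewrite ?leaft ?leafs; apply: leq_trans.
  have ub (x : nat) : (x <= (n %/ 2 ^ k).+1 ^ d -> x <= (2 * n0) ^ d)%N.
    move=> /leq_trans; apply; rewrite leq_exp2r ?(ltnW d_ge2) //.
    by rewrite mul2n -addnn -add1n leq_add.
  have : (#|label t| * #|label s| <= n0 ^ d * (2 * n0) ^ d)%N.
    case/orP: leaf; rewrite ?leaft ?leafs => leaf; last rewrite mulnC;
      by apply: leq_mul => //; exact: ub.
  move=> /leq_trans; apply; rewrite -expnMn.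
  apply: (@leq_trans ((8 * p ^ 2) ^ d)%N).
    by rewrite leq_exp2r ?(ltnW d_ge2) //; nia.
  rewrite expnMn -expnM -[leqLHS]muln1; apply: leq_mul => //.
  by rewrite leq_mul // leq_addl.
case: t s => [tau tch] [sigma sch] /= in rt rs nexp leaft leafs balt bals sidet sides dense *.
move: nexp; rewrite /expanding /=; case: ifP => /= _; last first.
  by rewrite -negb_or negbK => leaf; rewrite leaf; exact: dense.
move=> _.
apply: (@leq_trans (\sum_(l < d) (n0 * 2 ^ J + n0 * 2 ^ J) * p + p ^ (2 * d))%N).
  rewrite leq_add2r; apply: leq_sum => l _; rewrite leq_mul2r leq_add ?orbT //.
    exact: leq_trans (sidet l) mlt.
  exact: leq_trans (sides l) mlt.
rewrite sum_nat_const card_ord /leaf_constant.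
have p2 : (p ^ 2 <= p ^ (2 * d))%N by rewrite leq_pexp2l //; lia.
apply: (@leq_trans ((4 * d + 1) * p ^ (2 * d) * 2 ^ J)%N); last first.
  by rewrite !leq_mul // leq_addr.
have -> : ((4 * d + 1) * p ^ (2 * d) * 2 ^ J =
           4 * d * p ^ (2 * d) * 2 ^ J + p ^ (2 * d) * 2 ^ J)%N.
  by nia.
rewrite leq_add ?leq_pmulr //.
apply: (@leq_trans (d * (4 * p ^ 2 * 2 ^ J))%N); last first.
  have -> : (4 * d * p ^ (2 * d) * 2 ^ J = d * (4 * p ^ (2 * d) * 2 ^ J))%N by nia.
  by rewrite leq_mul2l !leq_mul ?orbT.
rewrite leq_mul2l; apply/orP; right.
have -> : ((n0 * 2 ^ J + n0 * 2 ^ J) * p = n0 * (2 * p * 2 ^ J))%N by nia.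
have -> : (4 * p ^ 2 * 2 ^ J = 2 * p * (2 * p * 2 ^ J))%N by nia.
by rewrite leq_mul2r n0_le orbT.
Qed.

(** A node too large to be a leaf has a side longer than [n0], and all sides agree
    up to one. *)
Lemma nonleaf_length k t :
  regular (n0 ^ d) k t -> ~~ nilp (children t) -> (n0 <= n %/ 2 ^ k)%N.
Proof.
move=> rt; rewrite (regular_leaf rt) -ltnNge; have [bal _ _] := rt.
have /andP[_ ub] := card_balanced_box bal.
by move=> /leq_trans/(_ ub); rewrite ltn_exp2r // (ltnW d_ge2).
Qed.

(** Every visited pair is the root or one of the at most [4 ^ d] children of an
    expanding pair, so summing over the expanding pairs of each level bounds
    the storage. *)
Lemma block_storage_le J k t s : (k + J = K)%N ->
  regular (n0 ^ d) k t -> regular (n0 ^ d) k s ->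
  (block_storage p (block_cluster_tree eta t s) <=
     leaf_constant * p ^ (2 * d) *
       (2 ^ J + 4 ^ d * \sum_(j < J) expanding_count j t s * 2 ^ (J - j.+1)))%N.
Proof.
elim: J k t s => [|J IH] k t s kJ rt rs;
    (have [ets|/(leaf_storage_le kJ rt rs)/leq_trans] := boolP (expanding t s);
      last by apply; rewrite leq_mul2l leq_addr orbT).
  (* at level K all sides are at most n0, so every cluster is a leaf *)
  have /and3P[_ tnil _] := ets; have := nonleaf_length rt tnil.
  rewrite -[k]addn0 kJ => n0le.
  suff : (n %/ 2 ^ K < n0)%N by rewrite ltnNge n0le.
  by rewrite ltn_divLR ?expn_gt0.
rewrite block_storage_expanding //.
set c := (leaf_constant * _)%N.
apply: (@leq_trans (\sum_(t' <- children t) \sum_(s' <- children s)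
  c * (2 ^ J + 4 ^ d * \sum_(j < J) expanding_count j t' s' * 2 ^ (J - j.+1)))%N).
  rewrite big_seq [leqRHS]big_seq; apply: leq_sum => t' tt'.
  rewrite big_seq [leqRHS]big_seq; apply: leq_sum => s' ss'.
  apply: (IH k.+1); first by rewrite addSnnS.
    exact: regular_child rt tt'.
  exact: regular_child rs ss'.
under eq_bigr => t' _ do rewrite -big_distrr big_split /= -big_distrr /=.
rewrite -big_distrr big_split /= -big_distrr /= leq_mul2l; apply/orP; right.
rewrite big_ord_recl subn1 /=.
have -> : (\sum_(t' <- children t) \sum_(s' <- children s)
    \sum_(j < J) expanding_count j t' s' * 2 ^ (J - j.+1) =
    \sum_(j < J) expanding_count (bump 0 j) t s * 2 ^ (J.+1 - (bump 0 j).+1))%N.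
  under eq_bigr => t' _ do rewrite exchange_big /=.
  rewrite exchange_big /=; apply: eq_bigr => j _.
  rewrite /bump add1n subSS expanding_countS big_distrl /=.
  by apply: eq_bigr => t' _; rewrite big_distrl.
rewrite [X in (_ <= _ + X)%N]mulnDr addnA leq_add2r.
apply: leq_trans (leq_addl _ _).
rewrite /expanding_count /= !big_seq1 ets mul1n.
rewrite !big_const_seq !count_predT !iter_addn_0 -mulnA [leqRHS]mulnC.
rewrite leq_mul2l (_ : 4 = 2 * 2)%N // expnMn; apply/orP; right.
by rewrite leq_mul ?(regular_size_children rt) ?(regular_size_children rs).
Qed.

(** Only boundedly many nodes of a level fail to be far from a given one: they
    all lie in a box five times as wide, are disjoint, and have comparable
    volume. *)
Lemma expanding_partners_le k T t : regular (n0 ^ d) 0 T -> t \in level k T ->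
  (\sum_(s <- level k T) expanding t s <= 10 ^ d)%N.
Proof.
move=> rT Tt; have rt := regular_level rT Tt; rewrite add0n in rt.
have [tleaf|tnleaf] := boolP (nilp (children t)).
  by rewrite big1 // => s _; rewrite /expanding tleaf /= andbF.
set m := (n %/ 2 ^ k)%N.
have m_gt0 : (0 < m)%N by apply: leq_trans (nonleaf_length rt tnleaf).
have [[a [b [tE ab]]] _ _] := rt.
pose B := box n (fun l => a l - 2 * m.+1)%N (fun l => b l + 2 * m.+1)%N.
have cardB : (#|B| <= (10 * m) ^ d)%N.
  rewrite card_tensor_set -[X in (_ ^ X)%N]card_ord -prod_nat_const.
  by apply: leq_prod => l _; rewrite card_ord_interval; have := ab l; lia.
have volume s : s \in level k T -> expanding t s ->
    (m ^ d <= \sum_(x in label s) (x \in B))%N.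
  move=> Ts /and3P[nadm _ _]; have rs := regular_level rT Ts.
  rewrite add0n in rs; have [bals _ _] := rs.
  have [a' [b' [sE ab']]] := bals.
  have sB : label s \subset B.
    apply/fintype.subsetP => x; rewrite sE !mem_box => /forallP xs.
    apply/forallP => l; apply: contraR nadm => far; rewrite tE sE.
    apply: (@admissible_far_boxes R d n n_gt0 _ _ _ _ m.+1 l).
    - by move=> l'; have := ab l'; lia.
    - by move=> l'; have := ab' l'; lia.
    - by rewrite -tE; exact: regular_label_neq0 rt.
    - by rewrite -sE; exact: regular_label_neq0 rs.
    - by move: far (xs l) (ab l) (ab' l); lia.
  rewrite (eq_bigr (fun=> 1%N)) => [|x /(fintype.subsetP sB) -> //].
  by rewrite sum1_card; case/andP: (card_balanced_box bals).
rewrite -(@leq_pmul2r (m ^ d)) ?expn_gt0 ?m_gt0 // -expnMn.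
apply: leq_trans cardB.
apply: (@leq_trans (\sum_(s <- level k T) \sum_(x in label s) (x \in B))%N).
  rewrite big_distrl /= big_seq [leqRHS]big_seq; apply: leq_sum => s Ts.
  by case: (boolP (expanding t s)) => [/(volume s Ts)|]; rewrite ?mul1n ?mul0n.
have [_ part _] := rT.
apply: leq_trans (level_weight_le _ _ part) _.
rewrite -sum1_card [leqRHS]big_mkcond [leqLHS]big_mkcond; apply: leq_sum => x _.
by case: (x \in label T); case: (x \in B).
Qed.

Lemma expanding_count_le j T : regular (n0 ^ d) 0 T ->
  (expanding_count j T T <= (2 ^ d) ^ j * 10 ^ d)%N.
Proof.
move=> rT; apply: (@leq_trans (\sum_(t <- level j T) 10 ^ d)%N).
  rewrite /expanding_count big_seq [leqRHS]big_seq; apply: leq_sum => t Tt.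
  exact: expanding_partners_le.
rewrite big_const_seq count_predT iter_addn_0 mulnC leq_mul2r.
by rewrite (regular_size_level j rT) orbT.
Qed.

(** The finest level dominates, since the number of clusters per level grows at
    least twice as fast as the cost of a leaf pair decreases. *)
Lemma sum_levels_le :
  (\sum_(j < K) (2 ^ d) ^ j * 2 ^ (K - j.+1) <= (2 ^ d) ^ K)%N.
Proof.
have D4 : (4 <= 2 ^ d)%N by rewrite (@leq_pexp2l 2 2).
elim: K => [|L IH]; first by rewrite big_ord0.
rewrite big_ord_recr subnn muln1 /=.
under eq_bigr => j _ do rewrite subSn // expnS mulnCA.
rewrite -big_distrr /= expnS.
apply: (@leq_trans (4 * (2 ^ d) ^ L)%N); last by rewrite leq_mul2r D4 orbT.
by rewrite (_ : 4 = 2 + 2)%N // mulnDl leq_add ?leq_pmull // leq_mul2l IH.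
Qed.

Lemma root_storage_le (T : cluster_tree (multi_index d n)) : regular (n0 ^ d) 0 T ->
  (block_storage p (block_cluster_tree eta T T) <=
     leaf_constant * (1 + 4 ^ d * 10 ^ d) * p ^ (2 * d) * (2 ^ d) ^ K)%N.
Proof.
move=> rT; apply: leq_trans (block_storage_le (add0n K) rT rT) _.
suff : (2 ^ K + 4 ^ d * \sum_(j < K) expanding_count j T T * 2 ^ (K - j.+1) <=
  (1 + 4 ^ d * 10 ^ d) * (2 ^ d) ^ K)%N.
  move=> le; rewrite [leqRHS](_ : _ = leaf_constant * p ^ (2 * d) *
    ((1 + 4 ^ d * 10 ^ d) * (2 ^ d) ^ K))%N; last by nia.
  by rewrite leq_mul2l le orbT.
rewrite mulnDl mul1n leq_add //.
  by rewrite -expnM leq_pexp2l //; nia.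
rewrite -mulnA leq_mul2l; apply/orP; right.
apply: (@leq_trans (10 ^ d * \sum_(j < K) (2 ^ d) ^ j * 2 ^ (K - j.+1))%N).
  rewrite big_distrr /=; apply: leq_sum => j _.
  by rewrite mulnA [(10 ^ d * _)%N]mulnC leq_mul2r expanding_count_le ?orbT.
by rewrite leq_mul2l sum_levels_le orbT.
Qed.

End Recursion.

(** * The storage bound *)

Lemma regular_root (d n N0 : nat) (T : cluster_tree (multi_index d n)) :
  is_cluster_tree T -> recursive_uniform_partition N0 T -> regular N0 0 T.
Proof.
move=> [labT part] unif; split => //.
exists (fun=> 0%N), (fun=> n); split; last by move=> l; rewrite divn1; lia.
by rewrite labT; apply/setP => i; rewrite mem_box inE; apply/esym/forallP => l /=.
Qed.

(** The disjunction records minimality of [K]. *)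
Lemma depth_exists (n n0 : nat) : (0 < n0)%N ->
  exists K, (n < n0 * 2 ^ K)%N /\ (K = 0 \/ n0 * 2 ^ K <= 2 * n)%N.
Proof.
move=> n0_gt0.
have exK : exists K, (n < n0 * 2 ^ K)%N.
  exists n; apply: leq_trans (ltn_expl n (ltnSn 1)) _.
  by rewrite leq_pmull.
case: (ex_minnP exK) => K nK minK; exists K; split=> //.
case: K nK minK => [|K] nK minK; [by left|right].
rewrite expnS mulnCA leq_mul2l /= leqNgt.
by apply/negP => /minK; rewrite ltnn.
Qed.

Definition storage_constant (d : nat) : nat :=
  (leaf_constant d * (1 + 4 ^ d * 10 ^ d) * 2 ^ d)%N.

Lemma storage_le (R : realType) (d n n0 p : nat)
    (T : cluster_tree (multi_index d n))
    (H : htlr R p (block_cluster_tree (Num.sqrt d%:R : R) T T)) :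
  (2 <= d)%N -> (0 < n)%N -> (0 < n0)%N -> (0 < p)%N -> (p <= n0 <= 2 * p)%N ->
  is_cluster_tree T -> recursive_uniform_partition (n0 ^ d) T ->
  (storage H <= storage_constant d * p ^ d * n ^ d)%N.
Proof.
move=> d_ge2 n_gt0 n0_gt0 p_gt0 /andP[p_le n0_le] treeT unifT.
have d_gt0 := ltnW d_ge2.
have rT := regular_root treeT unifT; rewrite storage_block_storage {H}.
have [K [nK [K0|Kn]]] := depth_exists n n0_gt0.
- (* a single dense block *)
  move: nK; rewrite K0 muln1 => n_lt; have [labT _] := treeT.
  have cardT : #|label T| = (n ^ d)%N.
    by rewrite labT cardsT card_ffun !card_ord.
  have leafT : nilp (children T).
    by rewrite (regular_leaf rT) cardT leq_exp2r // ltnW.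
  have -> : block_storage p (block_cluster_tree (Num.sqrt d%:R : R) T T) =
      (n ^ d * n ^ d)%N.
    rewrite -cardT; case: T {treeT unifT rT cardT} labT leafT => [tau ch] /= labT leafT.
    by rewrite labT (negbTE (not_admissible_self _ _ _)) // leafT.
  rewrite leq_mul2r; apply/orP; right.
  apply: (@leq_trans ((2 * p) ^ d)%N).
    by rewrite leq_exp2r // (leq_trans (ltnW n_lt)).
  rewrite expnMn leq_mul2r /storage_constant leq_pmull ?orbT //.
  by rewrite /leaf_constant muln_gt0 !addn_gt0 !orbT.
- have := @root_storage_le R d n p n0 K d_ge2 n_gt0 p_gt0 n0_gt0 n0_le nK T rT.
  move=> /leq_trans; apply.
  have pK : (p ^ d * (2 ^ d) ^ K <= 2 ^ d * n ^ d)%N.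
    rewrite -[((2 ^ d) ^ K)%N]expnM [(d * K)%N]mulnC expnM -!expnMn leq_exp2r //.
    by apply: leq_trans Kn; rewrite leq_mul2r p_le orbT.
  have -> : (p ^ (2 * d) = p ^ d * p ^ d)%N by rewrite mul2n -addnn expnD.
  rewrite /storage_constant -!mulnA leq_mul2l; apply/orP; right.
  rewrite leq_mul2l; apply/orP; right.
  by rewrite [leqRHS]mulnCA leq_mul2l pK orbT.
Qed.

Theorem proposition3p9 (R : realType) (d : nat) (hd : (2 <= d)%N) :
  exists C : R,
    forall (n n0 p : nat),
      (0 < n)%N -> (0 < n0)%N -> (0 < p)%N -> (p <= n0 <= 2 * p)%N ->
    forall T : cluster_tree (multi_index d n),
      is_cluster_tree T ->
      is_tensor_node_tree T ->
      recursive_uniform_partition (n0 ^ d) T ->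
    forall (A : multi_index d n -> multi_index d n -> R)
           (H : htlr R p (block_cluster_tree (Num.sqrt d%:R : R) T T)),
      stores H A ->
      (storage H)%:R <= C * p%:R ^+ d * (n ^ d)%N%:R.
Proof.
exists (storage_constant d)%:R => n n0 p n_gt0 n0_gt0 p_gt0 n0p T treeT _ unifT.
move=> A H _; rewrite -natrX -!natrM ler_nat.
exact: storage_le n0p treeT unifT.
Qed.
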